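(* Suppose there exists $C_F>0$ such that $\|F(D)\|<C_F$ for every $D\in\mathcal{D}$. Then for all $y,y'\in\mathbb{R}^m$, $$d_{\mathrm{Hell}}\left(\mu^y,\mu^{y'}\right)\le \exp\left(\frac{3\,\sigma(y,y')^2}{4\sigma^2}\right)\frac{\sigma(y,y')}{\sigma}\,\frac{\|y-y'\|}{\sigma}.$$ Furthermore, for every $r>0$ there exists $C(r)>0$ such that $$d_{\mathrm{Hell}}\left(\mu^y,\mu^{y'}\right)\le C(r)\,\|y-y'\|$$ for every $y,y'\in\mathbb{R}^m$ with $\|y\|<r$ and $\|y'\|<r$.
   Context: Let $d,m$ be positive integers and $\sigma>0$ a real number. Let $\mathcal{D}$ be a (finite or infinite) family of bounded domains (connected open subsets) of $\mathbb{R}^d$, let $\mathcal{B}$ be a $\sigma$-field on $\mathcal{D}$, let $\mu_0$ be a probability measure on $(\mathcal{D},\mathcal{B})$ (the prior), and let $F:\mathcal{D}\to\mathbb{R}^m$ be a map measurable on $(\mathcal{D},\mathcal{B})$ (the forward operator). $\|\cdot\|$ is the standard Euclidean norm. For $D\in\mathcal{D}$ and $y\in\mathbb{R}^m$ define $$\Phi(D;y):=\exp\left(-\frac{1}{2\sigma^2}\|y-F(D)\|^2\right),\qquad Z(y):=\int_{\mathcal{D}}\Phi(D;y)\,\mu_0(dD),$$ and let $\mu^y$ (the posterior) be the probability measure on $\mathcal{D}$ given by $$\mu^y(dD):=\frac{1}{Z(y)}\Phi(D;y)\,\mu_0(dD).$$ For $y,y'\in\mathbb{R}^m$ define (this two-argument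 quantity is distinct from the constant $\sigma$) $$\sigma(y,y'):=\sup\left\{\max\{\|y-F(D)\|,\|y'-F(D)\|\}: D\in\mathcal{D}\right\}.$$ The Hellinger distance is $$d_{\mathrm{Hell}}\left(\mu^y,\mu^{y'}\right):=\sqrt{\frac12\int_{\mathcal{D}}\left\{\sqrt{\frac{d\mu^y}{d\mu_0}(D)}-\sqrt{\frac{d\mu^{y'}}{d\mu_0}(D)}\right\}^2\mu_0(dD)}.$$ *)

(* Defs.v *)
From HB Require Import structures.
From mathcomp Require Import all_boot all_order all_algebra.
From mathcomp Require Import all_classical all_reals all_analysis.
From mathcomp Require Import measurable_realfun.

Set Implicit Arguments.
Unset Strict Implicit.
Unset Printing Implicit Defensive.

Import Order.TTheory GRing.Theory Num.Theory.
Import numFieldTopology.Exports numFieldNormedType.Exports.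

Local Open Scope classical_set_scope.
Local Open Scope ring_scope.
Local Open Scope charge_scope.

(* The library norm on ['rV[R]_n] is the max norm, hence this definition. *)
Definition enorm {R : realType} {n : nat} (v : 'rV[R]_n) : R :=
  Num.sqrt (\sum_(i < n) v ord0 i ^+ 2).

(* [bounded_set] refers to the max norm, which bounds the same sets as
   [enorm]. *)
Definition bounded_domain {R : realType} {d : nat} (A : set 'rV[R]_d) : Prop :=
  [/\ open A, connected A & bounded_set A].

(* [measurableType] requires a pointed carrier; nonemptiness is no loss here
   since a family carrying a probability measure is nonempty. *)
Record domain_family (R : realType) (d : nat) := DomainFamily {
  family_set :> set (set 'rV[R]_d) ;
  family_domain : forall A, family_set A -> bounded_domain A ;
  family_neq0 : family_set !=set0 }.

Section members.
Variables (R : realType) (d : nat) (D : domain_family R d).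

Definition members : Type := set_type D.

HB.instance Definition _ := Choice.on members.

Let members_point : members :=
  let: exist _ DA := cid (family_neq0 D) in SigSub (mem_set DA).

HB.instance Definition _ := isPointed.Build members members_point.

End members.

(* R^m with its Borel sigma-algebra. *)
Notation borel_rV R m := (g_sigma_algebraType (@open 'rV[R]_m)).

Lemma continuous_borel_rV_measurable (R : realType) (m : nat)
    (f : 'rV[R]_m -> R) :
  continuous f -> measurable_fun [set: borel_rV R m] (f : borel_rV R m -> R).
Proof.
move=> cf; apply: (measurability _ (RGenOpens.measurableE R)).
move=> _ [_ [a [b ->] <-]]; rewrite setTI; apply: sub_sigma_algebra.
by move/continuousP : cf; apply; exact: interval_open.
Qed.

Section posterior.
Context {dsp : measure_display} {T : measurableType dsp} {R : realType}
  {m : nat}.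
Variables (sigma : R) (mu0 : probability T R) (F : {mfun T >-> borel_rV R m}).
Implicit Types (y : 'rV[R]_m) (x : T).

Definition likelihood y x : R :=
  expR (- (1 / (2 * sigma ^+ 2)) * enorm (y - F x) ^+ 2).

Definition evidence y : R := (\int[mu0]_x likelihood y x)%R.

Definition posterior y (A : set T) : \bar R :=
  (\int[mu0]_(x in A) (1 / evidence y * likelihood y x)%:E)%E.

Definition sup_misfit y y' : R :=
  sup [set Num.max (enorm (y - F x)) (enorm (y' - F x)) | x in [set: T]].

Let likelihood_gt0 y x : 0 < likelihood y x.
Proof. exact: expR_gt0. Qed.

Let likelihood_le1 y x : likelihood y x <= 1.
Proof.
rewrite /likelihood -expR0 ler_expR mulNr oppr_le0.
by rewrite mulr_ge0 ?sqr_ge0// divr_ge0// mulr_ge0 ?sqr_ge0.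
Qed.

Let measurable_likelihood y : measurable_fun [set: T] (likelihood y).
Proof.
pose g (v : borel_rV R m) : R :=
  expR (- (1 / (2 * sigma ^+ 2)) * enorm (y - v : 'rV[R]_m) ^+ 2).
suff mg : measurable_fun [set: borel_rV R m] g.
  by apply: (measurableT_comp mg); exact: measurable_funPT.
rewrite /g /enorm; apply: measurableT_comp => //.
apply: measurable_funM => //; apply: measurable_funX.
apply: measurableT_comp.
  by apply: continuous_measurable_fun; exact: sqrt_continuous.
apply: measurable_sum => i; apply: measurable_funX.
apply: (@continuous_borel_rV_measurable R m (fun v => (y - v) ord0 i)) => v.
rewrite (_ : (fun w => (y - w) ord0 i) = fun w : 'rV[R]_m => y ord0 i - w ord0 i).
  by apply: continuousB; [exact: cst_continuous|exact: coord_continuous].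
by apply/funext => w; rewrite !mxE.
Qed.

Let integrable_likelihood y :
  mu0.-integrable [set: T] (fun x => (likelihood y x)%:E).
Proof.
apply: (@le_integrable _ _ _ mu0 _ measurableT _ (cst 1%E)) => //.
- exact/measurable_EFinP/measurable_likelihood.
- by move=> x _ /=; rewrite lee_fin normr1 ger0_norm// ltW.
- exact: finite_measure_integrable_cst.
Qed.

Let EFin_evidence y :
  (\int[mu0]_x (likelihood y x)%:E)%E = (evidence y)%:E.
Proof. by rewrite fineK//; exact: integrable_fin_num. Qed.

Let evidence_gt0 y : 0 < evidence y.
Proof.
rewrite lt_neqAle Rintegral_ge0 ?andbT; last by move=> x _; exact: ltW.
apply/eqP => Z0.
have /(ae_eq_integral_abs mu0 measurableT)[] :
    measurable_fun [set: T] (fun x => (likelihood y x)%:E).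
  exact/measurable_EFinP.
have -> : (\int[mu0]_x `|(likelihood y x)%:E| = 0)%E.
  transitivity (evidence y)%:E; last by rewrite -Z0.
  rewrite -EFin_evidence.
  by apply: eq_integral => x _; rewrite gee0_abs// lee_fin ltW.
move=> /(_ erefl)[N [mN N0 sN]] _.
have NT : N = [set: T].
  apply/seteqP; split=> // x _; apply: sN => /= /(_ Logic.I) [] /eqP.
  by rewrite gt_eqF.
have := probability_setT mu0; rewrite -NT N0 => /eqP.
by rewrite eq_sym onee_eq0.
Qed.

Let integrable_density y :
  mu0.-integrable [set: T]
    (fun x => (1 / evidence y * likelihood y x)%:E).
Proof.
under eq_fun do rewrite EFinM.
exact: integrableZl.
Qed.

Let density_ge0 y x : (0 <= (1 / evidence y * likelihood y x)%:E)%E.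
Proof. by rewrite lee_fin mulr_ge0// ltW// divr_gt0. Qed.

Let posterior0 y : posterior y set0 = 0%E.
Proof. by rewrite /posterior integral_set0. Qed.

Let posterior_ge0 y A : (0 <= posterior y A)%E.
Proof. by apply: integral_ge0 => x _; exact: density_ge0. Qed.

Let posterior_sigma_additive y : semi_sigma_additive (posterior y).
Proof.
move=> /= A mA tA mUA; rewrite /posterior integral_bigcup//=; last first.
  by apply: (integrableS _ _ (@subsetT _ _)) => //; exact: integrable_density.
apply: is_cvg_ereal_nneg_natsum_cond => n _ _.
by apply: integral_ge0 => /= x _; exact: density_ge0.
Qed.

HB.instance Definition _ y := isMeasure.Build _ _ _ (posterior y)
  (posterior0 y) (posterior_ge0 y) (@posterior_sigma_additive y).

Let posterior_setT y : posterior y [set: T] = 1%E.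
Proof.
rewrite /posterior; under eq_integral do rewrite EFinM.
by rewrite integralZl// EFin_evidence -EFinM div1r mulVf// gt_eqF.
Qed.

HB.instance Definition _ y :=
  Measure_isProbability.Build _ _ _ (posterior y) (posterior_setT y).

End posterior.

(* The integrand is meant for [nu1] and [nu2] absolutely continuous with
   respect to [mu]: ['d nu '/d mu] is then finite everywhere, and nonnegative
   almost everywhere. *)
Definition hellinger {dsp : measure_display} {T : measurableType dsp}
    {R : realType} (mu nu1 nu2 : probability T R) : R :=
  Num.sqrt (1 / 2 * \int[mu]_x
    (Num.sqrt (fine (('d (charge_of_finite_measure nu1) '/d mu) x)) -
     Num.sqrt (fine (('d (charge_of_finite_measure nu2) '/d mu) x))) ^+ 2)%R.

(* Main.v *)
Require Import Defs.
From mathcomp Require Import all_boot all_order all_algebra.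
From mathcomp Require Import all_classical all_reals all_analysis.
From mathcomp Require Import measurable_realfun ring lra.

(** Write [a], [a'] for the square roots of the two likelihoods, so that the
    two densities have square roots [a / sqrt Z] and [a' / sqrt Z'], where [Z]
    and [Z'] are the squared norms of [a] and [a'] in [L^2(mu0)].  The twice
    squared Hellinger distance is thus the squared distance between two
    normalized vectors, and normalization costs little: for nonzero [u], [v]
    in a Hilbert space,
      [|u/|u| - v/|v||^2 = 2 - 2<u,v>/(|u||v|) <= |u - v|^2 / (|u||v|)],
    by the arithmetic-geometric inequality.  This is [hellinger_normalized_le].

    It remains to bound [|a - a'|] above and [Z], [Z'] below.  Let [S] bound
    all misfits.  Since [a = exp (- t^2 / (4 sigma^2))] with [t] the misfit,
    since [exp (- _)] is 1-Lipschitz on the nonnegative reals, and since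
    [|t^2 - t'^2| <= 2 S |t - t'| <= 2 S |y - y'|], one gets
    [|a - a'| <= S |y - y'| / (2 sigma^2)] ([sqrt_likelihood_lipschitz]).
    As [mu0] has mass one, [Z, Z' >= exp (- S^2 / (2 sigma^2))]
    ([evidence_ge]).  Together these give
    [d_Hell <= exp (S^2 / (4 sigma^2)) S |y - y'| / (2 sqrt 2 sigma^2)], which
    is stronger than the claimed bound with [S = sup_misfit F y y'].  When [y]
    and [y'] have norm less than [r], the triangle inequality allows the
    choice [S = r + C_F], which is uniform in [y] and [y'].

    The Hellinger distance is defined through Radon-Nikodym derivatives, known
    only almost everywhere; they agree almost everywhere with the explicit
    densities ([ae_eq_Radon_Nikodym]), which is enough under the integral. *)

Set Implicit Arguments.
Unset Strict Implicit.
Unset Printing Implicit Defensive.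

Import Order.TTheory GRing.Theory Num.Theory.
Import numFieldTopology.Exports numFieldNormedType.Exports.

Local Open Scope classical_set_scope.
Local Open Scope ring_scope.

(** * The Euclidean norm *)

(** The Cauchy-Schwarz inequality, from Lagrange's identity: the difference of
    the two sides is half a double sum of squares. *)
Lemma sum_mul_sqr_le (R : realDomainType) (n : nat) (u v : 'I_n -> R) :
  (\sum_i u i * v i) ^+ 2 <= (\sum_i u i ^+ 2) * (\sum_i v i ^+ 2).
Proof.
have : 0 <= \sum_i \sum_j (u i * v j - u j * v i) ^+ 2.
  by apply: sumr_ge0 => i _; apply: sumr_ge0 => j _; exact: sqr_ge0.
have -> : \sum_i \sum_j (u i * v j - u j * v i) ^+ 2 =
    \sum_i \sum_j u i ^+ 2 * v j ^+ 2 + \sum_i \sum_j v i ^+ 2 * u j ^+ 2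
    - 2 * \sum_i \sum_j (u i * v i) * (u j * v j).
  rewrite mulr_sumr -big_split -sumrB; apply: eq_bigr => i _.
  rewrite mulr_sumr -big_split -sumrB; apply: eq_bigr => j _ /=; ring.
rewrite -!big_distrlr /=; lra.
Qed.

Section euclidean_norm.
Context {R : realType} {n : nat}.
Implicit Types u v : 'rV[R]_n.

Lemma enorm_ge0 u : 0 <= enorm u.
Proof. exact: sqrtr_ge0. Qed.

Lemma sqr_enorm u : enorm u ^+ 2 = \sum_i u ord0 i ^+ 2.
Proof. by rewrite sqr_sqrtr// sumr_ge0// => i _; exact: sqr_ge0. Qed.

Lemma enormN u : enorm (- u) = enorm u.
Proof. by congr Num.sqrt; apply: eq_bigr => i _; rewrite mxE sqrrN. Qed.

Lemma enormD_le u v : enorm (u + v) <= enorm u + enorm v.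
Proof.
rewrite -(@ler_pXn2r _ 2)// ?nnegrE ?addr_ge0 ?enorm_ge0//.
have uv : \sum_i u ord0 i * v ord0 i <= enorm u * enorm v.
  apply: le_trans (ler_norm _) _.
  rewrite -(@ler_pXn2r _ 2)// ?nnegrE ?mulr_ge0 ?enorm_ge0//.
  by rewrite real_normK ?num_real// exprMn !sqr_enorm sum_mul_sqr_le.
rewrite sqrrD !sqr_enorm.
under eq_bigr do rewrite mxE sqrrD.
by rewrite !big_split /= lerD2r lerD2l mulr2n lerD.
Qed.

Lemma ler_dist_enorm u v : `|enorm u - enorm v| <= enorm (u - v).
Proof.
have := enormD_le (u - v) v; have := enormD_le (v - u) u.
rewrite !subrK -[v - u]opprB enormN ler_norml; lra.
Qed.

End euclidean_norm.

(** * The Hellinger distance between measures with densities *)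

Section hellinger_density.
Context {dsp : measure_display} {T : measurableType dsp} {R : realType}.
Variable mu : probability T R.

Local Open Scope charge_scope.

Lemma density_null_dominates (nu : probability T R) (f : T -> R) :
  mu.-integrable [set: T] (EFin \o f) ->
  (forall A, measurable A -> nu A = \int[mu]_(x in A) (f x)%:E)%E ->
  charge_of_finite_measure nu `<< mu.
Proof.
move=> intf nuf; apply/null_content_dominatesP => A mA A0.
transitivity (nu A) => //; rewrite nuf//; apply: null_set_integral => //.
apply: measurable_funTS; exact: measurable_int intf.
Qed.

(** Two integrable functions with the same integral on every measurable set
    are equal almost everywhere. *)
Lemma ae_eq_Radon_Nikodym (nu : probability T R) (f : T -> R) :
  mu.-integrable [set: T] (EFin \o f) ->
  (forall A, measurable A -> nu A = \int[mu]_(x in A) (f x)%:E)%E ->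
  ae_eq mu [set: T] ('d (charge_of_finite_measure nu) '/d mu) (EFin \o f).
Proof.
move=> intf nuf; have numu := density_null_dominates intf nuf.
apply: integral_ae_eq => //.
- exact: Radon_Nikodym_integrable.
- exact: measurable_int intf.
- by move=> E _ mE; rewrite -Radon_Nikodym_integral// -nuf.
Qed.

Lemma hellinger_density (nu1 nu2 : probability T R) (f1 f2 : T -> R) :
  mu.-integrable [set: T] (EFin \o f1) ->
  mu.-integrable [set: T] (EFin \o f2) ->
  (forall A, measurable A -> nu1 A = \int[mu]_(x in A) (f1 x)%:E)%E ->
  (forall A, measurable A -> nu2 A = \int[mu]_(x in A) (f2 x)%:E)%E ->
  hellinger mu nu1 nu2 = Num.sqrt (1 / 2 *
    \int[mu]_x (Num.sqrt (f1 x) - Num.sqrt (f2 x)) ^+ 2).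
Proof.
move=> intf1 intf2 nuf1 nuf2.
have ae1 := ae_eq_Radon_Nikodym intf1 nuf1.
have ae2 := ae_eq_Radon_Nikodym intf2 nuf2.
have msqrt (g : T -> \bar R) : measurable_fun [set: T] g ->
    measurable_fun [set: T] (fun x => Num.sqrt (fine (g x))).
  move=> mg; apply: (measurableT_comp (f := @Num.sqrt R)).
    by apply: continuous_measurable_fun; exact: sqrt_continuous.
  exact: measurableT_comp.
have msqr (g h : T -> \bar R) : measurable_fun [set: T] g ->
    measurable_fun [set: T] h -> measurable_fun [set: T] (fun x =>
      ((Num.sqrt (fine (g x)) - Num.sqrt (fine (h x))) ^+ 2)%:E).
  move=> mg mh; apply/measurable_EFinP; apply: measurable_funX.
  by apply: measurable_funB; exact: msqrt.
rewrite /hellinger; congr (Num.sqrt (_ * _)); congr fine.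
apply: ae_eq_integral => //.
- apply: msqr; apply: measurable_int; apply: Radon_Nikodym_integrable.
    exact: density_null_dominates nuf1.
  exact: density_null_dominates nuf2.
- apply: (msqr (EFin \o f1) (EFin \o f2)).
    exact: measurable_int intf1.
  exact: measurable_int intf2.
- by apply: filterS2 ae1 ae2 => x e1 e2 xT; rewrite e1// e2.
Qed.

(** The estimate for normalized vectors in [L^2(mu)], applied to [sqrt f1] and
    [sqrt f2], whose squared norms are [Z1] and [Z2].  The inner product of
    the two square roots is avoided: a pointwise upper bound of the integrand
    by a linear combination of [f1], [f2] and a constant is integrated. *)
Lemma hellinger_normalized_le (nu1 nu2 : probability T R) (f1 f2 : T -> R)
    (L c : R) :
  let Z1 := \int[mu]_x f1 x in let Z2 := \int[mu]_x f2 x in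
  (forall x, 0 <= f1 x) -> (forall x, 0 <= f2 x) ->
  mu.-integrable [set: T] (EFin \o f1) ->
  mu.-integrable [set: T] (EFin \o f2) ->
  (forall A, measurable A ->
     nu1 A = \int[mu]_(x in A) (1 / Z1 * f1 x)%:E)%E ->
  (forall A, measurable A ->
     nu2 A = \int[mu]_(x in A) (1 / Z2 * f2 x)%:E)%E ->
  0 < c -> c <= Z1 -> c <= Z2 ->
  (forall x, `|Num.sqrt (f1 x) - Num.sqrt (f2 x)| <= L) ->
  hellinger mu nu1 nu2 <= Num.sqrt (1 / 2 * (L ^+ 2 / c)).
Proof.
move=> Z1 Z2 f1_ge0 f2_ge0 intf1 intf2 nuf1 nuf2 c_gt0 cZ1 cZ2 f12.
have intZ k (f : T -> R) : mu.-integrable [set: T] (EFin \o f) ->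
    mu.-integrable [set: T] (EFin \o (fun x => k * f x)).
  move=> intf; rewrite [X in integrable _ _ X](_ : _ =
    (fun x => k%:E * (EFin \o f) x)%E)//; exact: integrableZl.
have intD (f g : T -> R) : mu.-integrable [set: T] (EFin \o f) ->
    mu.-integrable [set: T] (EFin \o g) ->
    mu.-integrable [set: T] (EFin \o (fun x => f x + g x)).
  move=> intf intg; rewrite [X in integrable _ _ X](_ : _ =
    ((EFin \o f) \+ (EFin \o g))%E)//; exact: integrableD.
rewrite (hellinger_density (intZ _ _ intf1) (intZ _ _ intf2) nuf1 nuf2).
rewrite ler_wsqrtr// ler_pM2l//.
have Z1_gt0 : 0 < Z1 by exact: lt_le_trans cZ1.
have Z2_gt0 : 0 < Z2 by exact: lt_le_trans cZ2.
set s1 := Num.sqrt Z1; set s2 := Num.sqrt Z2.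
have s1_gt0 : 0 < s1 by rewrite sqrtr_gt0.
have s2_gt0 : 0 < s2 by rewrite sqrtr_gt0.
have Z1E : Z1 = s1 ^+ 2 by rewrite sqr_sqrtr// ltW.
have Z2E : Z2 = s2 ^+ 2 by rewrite sqr_sqrtr// ltW.
(* With [a] and [b] the square roots of [f1 x] and [f2 x], in the identity
     [(a/s1 - b/s2)^2 = (1/s1^2 - 1/(s1 s2)) a^2 + (1/s2^2 - 1/(s1 s2)) b^2
                        + (a - b)^2 / (s1 s2)],
   only the last term needs an estimate. *)
pose bound x := ((1 / Z1 - (s1 * s2)^-1) * f1 x +
  (1 / Z2 - (s1 * s2)^-1) * f2 x) + L ^+ 2 / (s1 * s2).
have le_bound x : (Num.sqrt (1 / Z1 * f1 x) - Num.sqrt (1 / Z2 * f2 x)) ^+ 2 <=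
    bound x.
  rewrite !div1r !sqrtrM ?invr_ge0 ?(ltW Z1_gt0) ?(ltW Z2_gt0)//.
  rewrite !sqrtrV ?(ltW Z1_gt0) ?(ltW Z2_gt0)// -/s1 -/s2.
  have abL := f12 x; set a := Num.sqrt (f1 x) in abL *.
  set b := Num.sqrt (f2 x) in abL *.
  have f1E : f1 x = a ^+ 2 by rewrite sqr_sqrtr.
  have f2E : f2 x = b ^+ 2 by rewrite sqr_sqrtr.
  rewrite /bound f1E f2E Z1E Z2E.
  have -> : (s1^-1 * a - s2^-1 * b) ^+ 2 = (1 / s1 ^+ 2 - (s1 * s2)^-1) * a ^+ 2
      + (1 / s2 ^+ 2 - (s1 * s2)^-1) * b ^+ 2 + (a - b) ^+ 2 / (s1 * s2).
    by field; rewrite !gt_eqF.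
  rewrite lerD2l ler_pM2r ?invr_gt0 ?mulr_gt0//.
  rewrite -[leLHS]real_normK ?num_real// ler_pXn2r ?nnegrE//.
  exact: le_trans abL.
have int1 := intZ (1 / Z1 - (s1 * s2)^-1) _ intf1.
have int2 := intZ (1 / Z2 - (s1 * s2)^-1) _ intf2.
have int12 := intD _ _ int1 int2.
have int3 : mu.-integrable [set: T] (EFin \o cst (L ^+ 2 / (s1 * s2))).
  exact: finite_measure_integrable_cst.
have int_bound : mu.-integrable [set: T] (EFin \o bound) by exact: intD int3.
apply: (@le_trans _ _ (\int[mu]_x bound x)).
  apply: le_Rintegral => //.
  apply: le_integrable int_bound => //.
    apply/measurable_EFinP; apply: measurable_funX.
    apply: measurable_funB; (apply: (measurableT_comp (f := @Num.sqrt R));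
      first by apply: continuous_measurable_fun; exact: sqrt_continuous);
      apply: measurable_funM => //; apply/measurable_EFinP.
    - exact: measurable_int intf1.
    - exact: measurable_int intf2.
  move=> x _ /=; rewrite lee_fin ger0_norm ?sqr_ge0//.
  exact: le_trans (le_bound x) (ler_norm _).
rewrite (RintegralD measurableT int12 int3) (RintegralD measurableT int1 int2).
rewrite [X in _ + X]Rintegral_cst// !RintegralZl//.
have -> : fine (mu [set: T]) = 1 by rewrite probability_setT.
rewrite -/Z1 -/Z2 mulr1.
(* The first two terms have a nonpositive total: this is where the
   arithmetic-geometric inequality for [s1] and [s2] enters. *)
have -> : (1 / Z1 - (s1 * s2)^-1) * Z1 + (1 / Z2 - (s1 * s2)^-1) * Z2 =
    - ((s1 - s2) ^+ 2 / (s1 * s2)).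
  by rewrite Z1E Z2E; field; rewrite !gt_eqF.
apply: (@le_trans _ _ (L ^+ 2 / (s1 * s2))).
  by rewrite gerDr oppr_le0 divr_ge0 ?sqr_ge0// mulr_ge0 ?ltW.
rewrite ler_wpM2l ?sqr_ge0// lef_pV2 ?posrE ?mulr_gt0//.
rewrite -(@ler_pXn2r _ 2) ?nnegrE ?mulr_ge0 ?(ltW c_gt0) ?sqrtr_ge0//.
by rewrite exprMn -Z1E -Z2E expr2 ler_pM// ltW.
Qed.

End hellinger_density.

(** * Misfits, likelihood and evidence *)

(** The exponential has derivative at most 1 on the nonpositive reals; the
    convexity bound [1 + x <= expR x] is enough to conclude. *)
Lemma ler_dist_expRN (R : realType) (a b : R) : 0 <= a -> 0 <= b ->
  `|expR (- a) - expR (- b)| <= `|a - b|.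
Proof.
wlog ab : a b / a <= b => [H a0 b0|a0 b0].
  by have [/H|/ltW/H] := leP a b; [exact|rewrite distrC (distrC a); exact].
have le_ba : expR (- b) <= expR (- a) by rewrite ler_expR lerN2.
rewrite ger0_norm ?subr_ge0// ler0_norm ?subr_le0// opprB.
have -> : expR (- b) = expR (- a) * expR (- (b - a)).
  by rewrite -expRD; congr expR; ring.
have := expR_ge1Dx (- (b - a)).
have : expR (- a) <= 1 by rewrite -expR0 ler_expR oppr_le0.
have := expR_ge0 (- a); nra.
Qed.

Section posterior_stability.
Context {dsp : measure_display} {T : measurableType dsp} {R : realType}
  {m : nat}.
Variables (sigma : R) (mu0 : probability T R) (F : {mfun T >-> borel_rV R m}).
Hypothesis sigma_gt0 : 0 < sigma.
Implicit Types y : 'rV[R]_m.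

Local Notation forward x := (F x : 'rV[R]_m).

Lemma misfit_le (C r : R) y x : enorm (forward x) <= C -> enorm y <= r ->
  enorm (y - forward x) <= r + C.
Proof.
by move=> FC yr; apply: le_trans (enormD_le _ _) _; rewrite enormN lerD.
Qed.

(** [sup] is only meaningful on nonempty sets that are bounded above; a bounded
    forward map makes the set of misfits such a set. *)
Lemma misfit_has_sup (C : R) y y' : (forall x, enorm (forward x) <= C) ->
  has_sup [set Num.max (enorm (y - forward x)) (enorm (y' - forward x)) |
    x in [set: T]].
Proof.
move=> FC; split.
  by exists (Num.max (enorm (y - forward point)) (enorm (y' - forward point)));
    exists point.
exists (Num.max (enorm y) (enorm y') + C) => _ [x _ <-].
by rewrite ge_max !misfit_le// le_max lexx ?orbT.
Qed.

Lemma le_sup_misfit (C : R) y y' x : (forall x, enorm (forward x) <= C) ->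
  enorm (y - forward x) <= sup_misfit F y y' /\
  enorm (y' - forward x) <= sup_misfit F y y'.
Proof.
move=> /misfit_has_sup FC.
have : Num.max (enorm (y - forward x)) (enorm (y' - forward x)) <=
    sup_misfit F y y'.
  by apply: sup_upper_bound; [exact: FC|exists x].
by rewrite ge_max => /andP.
Qed.

Lemma sqrt_likelihood y x :
  Num.sqrt (likelihood sigma F y x) =
  expR (- (enorm (y - forward x) ^+ 2 / (4 * sigma ^+ 2))).
Proof.
rewrite -[RHS]ger0_norm ?expR_ge0// -sqrtr_sqr -expRM_natl /likelihood.
by congr (Num.sqrt (expR _)); field; rewrite gt_eqF.
Qed.

Lemma measurable_likelihood y : measurable_fun [set: T] (likelihood sigma F y).
Proof.
apply: (measurableT_comp (f := expR)) => //.
apply: measurable_funM => //; under eq_fun do rewrite sqr_enorm.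
apply: measurable_sum => i; apply: measurable_funX.
have mcoord : measurable_fun [set: borel_rV R m]
    (fun v : borel_rV R m => (y - (v : 'rV[R]_m)) ord0 i).
  apply: (@continuous_borel_rV_measurable R m (fun v => (y - v) ord0 i)) => v.
  under eq_fun do rewrite !mxE.
  by apply: continuousB; [exact: cst_continuous|exact: coord_continuous].
by apply: (measurableT_comp mcoord); exact: measurable_funPT.
Qed.

Lemma integrable_likelihood y :
  mu0.-integrable [set: T] (EFin \o likelihood sigma F y).
Proof.
apply: (@le_integrable _ _ _ mu0 _ measurableT _ (cst 1%E)) => //.
- exact/measurable_EFinP/measurable_likelihood.
- move=> x _ /=; rewrite lee_fin normr1 ger0_norm ?expR_ge0//.
  rewrite -expR0 ler_expR mulNr oppr_le0 mulr_ge0 ?sqr_ge0//.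
  by rewrite divr_ge0// mulr_ge0 ?sqr_ge0.
- exact: finite_measure_integrable_cst.
Qed.

(** The exponents differ by [|a^2 - b^2| / (4 sigma^2)], and
    [|a^2 - b^2| = |a - b| (a + b)] where [|a - b|] is at most [|y - y'|] and
    [a + b] at most [2 S]. *)
Lemma sqrt_likelihood_lipschitz (S : R) y y' x :
  enorm (y - forward x) <= S -> enorm (y' - forward x) <= S ->
  `|Num.sqrt (likelihood sigma F y x) - Num.sqrt (likelihood sigma F y' x)| <=
  S * enorm (y - y') / (2 * sigma ^+ 2).
Proof.
move=> yS y'S; rewrite !sqrt_likelihood.
set a := enorm (y - forward x) in yS *; set b := enorm _ in y'S *.
have s_ge0 : 0 <= 4 * sigma ^+ 2 by rewrite mulr_ge0 ?sqr_ge0.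
apply: le_trans (ler_dist_expRN _ _) _; rewrite ?divr_ge0 ?sqr_ge0//.
have ab : `|a - b| <= enorm (y - y').
  apply: le_trans (ler_dist_enorm _ _) _.
  by rewrite opprB addrA subrK.
rewrite -mulrBl normrM [X in _ * X]ger0_norm ?invr_ge0// subr_sqr normrM.
have ab0 : 0 <= a + b by rewrite addr_ge0 ?enorm_ge0.
rewrite (ger0_norm ab0).
have -> : S * enorm (y - y') / (2 * sigma ^+ 2) =
    enorm (y - y') * (S + S) / (4 * sigma ^+ 2).
  by field; rewrite gt_eqF.
by rewrite ler_wpM2r ?invr_ge0// ler_pM// lerD.
Qed.

Lemma evidence_ge (S : R) y : (forall x, enorm (y - forward x) <= S) ->
  expR (- (S ^+ 2 / (2 * sigma ^+ 2))) <= evidence sigma mu0 F y.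
Proof.
move=> yS; set c := expR _.
have <- : \int[mu0]_x c = c.
  rewrite Rintegral_cst//.
  by have -> : fine (mu0 [set: T]) = 1; rewrite ?probability_setT ?mulr1.
apply: le_Rintegral => //.
- exact: finite_measure_integrable_cst.
- exact: integrable_likelihood.
move=> x _; rewrite /likelihood ler_expR mulNr lerN2 mulrC div1r.
rewrite ler_wpM2r ?invr_ge0 ?mulr_ge0 ?(ltW sigma_gt0)//.
rewrite ler_pXn2r ?nnegrE ?enorm_ge0//.
exact: le_trans (enorm_ge0 _) (yS x).
Qed.

(** * Stability of the posterior *)

(** Both parts of the theorem are instances: [S] is the supremum of the misfits
    in the first one, and a bound uniform in [y] and [y'] in the second. *)
Lemma hellinger_posterior_le (S : R) y y' :
  (forall x, enorm (y - forward x) <= S) ->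
  (forall x, enorm (y' - forward x) <= S) ->
  hellinger mu0 (posterior sigma mu0 F y) (posterior sigma mu0 F y') <=
  expR (3 * S ^+ 2 / (4 * sigma ^+ 2)) * (S / sigma) * (enorm (y - y') / sigma).
Proof.
move=> yS y'S.
have S_ge0 : 0 <= S := le_trans (enorm_ge0 _) (yS point).
set L := S * enorm (y - y') / (2 * sigma ^+ 2).
have L_ge0 : 0 <= L.
  by rewrite divr_ge0 ?mulr_ge0 ?enorm_ge0 ?(ltW sigma_gt0).
apply: le_trans (hellinger_normalized_le _ _ (integrable_likelihood y)
  (integrable_likelihood y') _ _ (expR_gt0 _) (evidence_ge yS) (evidence_ge y'S)
  (fun x => sqrt_likelihood_lipschitz (yS x) (y'S x))) _ => //.
- by move=> x; exact: expR_ge0.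
- by move=> x; exact: expR_ge0.
set q := S ^+ 2 / (4 * sigma ^+ 2).
have q_ge0 : 0 <= q by rewrite divr_ge0 ?mulr_ge0 ?(ltW sigma_gt0).
have sqE : expR (- (S ^+ 2 / (2 * sigma ^+ 2))) = (expR q ^+ 2)^-1.
  rewrite -expRM_natl -expRN; congr expR; rewrite /q.
  by field; rewrite gt_eqF.
have -> : 3 * S ^+ 2 / (4 * sigma ^+ 2) = q *+ 3.
  by rewrite /q; field; rewrite gt_eqF.
rewrite sqE invrK -/L.
have -> : expR (q *+ 3) * (S / sigma) * (enorm (y - y') / sigma) =
    expR (q *+ 3) * (2 * L).
  by rewrite /L; field; rewrite gt_eqF.
(* The bound from [hellinger_normalized_le] is [expR q * L / sqrt 2], and the
   target is [2 * expR (3 q) * L]. *)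
apply: (@le_trans _ _ (expR q * L)).
  have eL_ge0 : 0 <= expR q * L by rewrite mulr_ge0 ?expR_ge0.
  rewrite -[leRHS](ger0_norm eL_ge0) -sqrtr_sqr ler_wsqrtr//.
  rewrite [L ^+ 2 * _]mulrC -exprMn ler_piMl ?sqr_ge0//.
  by rewrite div1r invf_le1// ler1n.
rewrite ler_pM ?expR_ge0//.
  by rewrite ler_expR mulrS lerDl mulrn_wge0.
by rewrite ler_peMl// ler1n.
Qed.

End posterior_stability.

Theorem theorem3p1 (R : realType) (d m : nat) (d_gt0 : (0 < d)%N)
    (m_gt0 : (0 < m)%N) (sigma : R) (sigma_gt0 : 0 < sigma)
    (D : domain_family R d) (B : set (set (members D)))
    (B_sigma_algebra : sigma_algebra [set: members D] B)
    (mu0 : probability (g_sigma_algebraType B) R)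
    (F : {mfun g_sigma_algebraType B >-> borel_rV R m})
    (F_bounded : exists2 C_F : R, 0 < C_F &
      forall A : members D, enorm (F A : 'rV[R]_m) < C_F) :
  (forall y y' : 'rV[R]_m,
     hellinger mu0 (posterior sigma mu0 F y) (posterior sigma mu0 F y') <=
     expR (3 * sup_misfit F y y' ^+ 2 / (4 * sigma ^+ 2)) *
       (sup_misfit F y y' / sigma) * (enorm (y - y') / sigma)) /\
  (forall r : R, 0 < r -> exists2 C : R, 0 < C &
     forall y y' : 'rV[R]_m, enorm y < r -> enorm y' < r ->
       hellinger mu0 (posterior sigma mu0 F y) (posterior sigma mu0 F y') <=
       C * enorm (y - y')).
Proof.
have [C C_gt0 FltC] := F_bounded.
have FC A : enorm (F A : 'rV[R]_m) <= C by exact/ltW/FltC.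
split=> [y y'|r r_gt0].
  apply: hellinger_posterior_le => // x.
    by have [] := @le_sup_misfit _ _ _ _ F C y y' x FC.
  by have [] := @le_sup_misfit _ _ _ _ F C y y' x FC.
have rC_gt0 : 0 < r + C by rewrite addr_gt0.
exists (expR (3 * (r + C) ^+ 2 / (4 * sigma ^+ 2)) * ((r + C) / sigma) / sigma).
  by rewrite divr_gt0 ?mulr_gt0 ?expR_gt0 ?invr_gt0.
move=> y y' /ltW yr /ltW y'r; rewrite -mulrA [_^-1 * _]mulrC.
by apply: hellinger_posterior_le => // x; exact: misfit_le (FC x) _.
Qed.
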